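(* Let $(X,\rho_X)$ be a metric space and let $\mathrm{Cone}_\omega(X,c,d)$ be any asymptotic cone of $X$, i.e. the asymptotic cone associated with an infinite set $I$, a non-principal ultrafilter $\omega$ on $I$, a function $c\colon I\to X$, and a family $d=\{d_i\}_{i\in I}$ of positive real numbers with $\lim_\omega \frac{1}{d_i}=0$. Then $$\dim(\mathrm{Cone}_\omega(X,c,d))\leq \dim_{AN}(\mathrm{Cone}_\omega(X,c,d))\leq \mathrm{asdim}_{AN}(X,\rho_X).$$
   Context: Asymptotic cone: let $I$ be an infinite set, $\omega$ a non-principal ultrafilter on $I$, $c\colon I\to X$ a function (the base point), and $d=\{d_i\}_{i\in I}$ positive reals such that the $\omega$-limit of $\{1/d_i\}_{i\in I}$ is $0$. Consider the set of all functions $x\colon I\to X$ such that $\left\{\frac{\rho_X(x(i),c(i))}{d_i}\right\}_{i\in I}$ is bounded, with the pseudo-metric $(x,y)\mapsto \lim_\omega \frac{\rho_X(x(i),y(i))}{d_i}$. Identifying functions at distance $0$ gives the metric space $\mathrm{Cone}_\omega(X,c,d)$. (For $I=\mathbb{N}$ and $d_n\to\infty$ this is the usual asymptotic cone.) Assouad-Nagata dimension: $\dim_{AN}(X)\leq n$ means that there is a constant $K>0$ such that for every $r>0$ there is a cover $\mathcal{U}_r$ of $X$ whose elements have diameter at most $K\cdot r$ and such that every $r$-ball $B(x,r)$ intersects at most $n+1$ elements of $\mathcal{U}_r$. Asymptotic Assouad-Nagata dimension: $\mathrm{asdim}_{AN}(X)\leq n$ means that there is a constant $K>0$ such that for all sufficiently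 large $r$ there is a cover $\mathcal{U}_r$ of $X$ whose elements have diameter at most $K\cdot r$ and such that every $r$-ball $B(x,r)$ intersects at most $n+1$ elements of $\mathcal{U}_r$. The dimension is the least such integer $n\ge 0$, or $\infty$ if there is none. $\dim$ denotes the (Lebesgue) covering dimension of a topological space. *)

(* Defs.v *)
From HB Require Import structures.
From mathcomp Require Import all_boot all_order all_algebra.
From mathcomp Require Import generic_quotient.
From mathcomp Require Import all_classical all_reals all_analysis.

Set Implicit Arguments.
Unset Strict Implicit.
Unset Printing Implicit Defensive.

Import Order.TTheory GRing.Theory Num.Theory.
Import numFieldNormedType.Exports.

Local Open Scope classical_set_scope.
Local Open Scope ring_scope.
Local Open Scope quotient_scope.
Local Open Scope card_scope.

Section cone_fun.
Context {R : realType} {X : metricType R} {I : Type}.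

Definition cone_fun (c : I -> X) (d : I -> {posnum R}) :=
  {x : I -> X | `[< bounded_fun (fun i => mdist (x i) (c i) / (d i)%:num) >]}.

Variables (w : set_system I) (c : I -> X) (d : I -> {posnum R}).

Definition cone_pdist (x y : cone_fun c d) : R :=
  lim ((fun i => mdist (val x i) (val y i) / (d i)%:num) @ w).

Context {wU : UltraFilter w}.

Lemma ultra_bounded_cvg (f : I -> R) (M : R) :
  (forall i, `|f i| <= M) -> cvg (f @ w).
Proof.
move=> fM.
have fwU : UltraFilter (f @ w).
  split; first exact: fmap_proper_filter.
  move=> G GF sG; apply/seteqP; split => [A GA|]; last exact: sG.
  have [//|wA] := in_ultra_setVsetC (f @^-1` A) wU.
  have /sG GnA : (f @ w) (~` A) by [].
  have := filterI GA GnA; rewrite setICr => G0.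
  by case: (filter_not_empty G); exact: G0.
have := @segment_compact R (- M) M; rewrite compact_ultra => /(_ (f @ w) fwU).
have wT : (f @ w) [set` `[- M, M]].
  rewrite /fmap /=; apply: (filterE (F := w)) => i.
  by rewrite /= in_itv /= -ler_norml.
by case/(_ wT) => l [_ fl]; apply/cvg_ex; exists l.
Qed.

Lemma cone_fun_bounded (x : cone_fun c d) :
  exists M, forall i, mdist (val x i) (c i) / (d i)%:num <= M.
Proof.
have /asboolP[M [_ Mx]] := valP x.
exists (M + 1) => i; apply: le_trans (ler_norm _) _.
by apply: (Mx (M + 1)) => //; rewrite ltrDl.
Qed.

Lemma cone_pdist_cvg (x y : cone_fun c d) :
  (fun i => mdist (val x i) (val y i) / (d i)%:num) @ w --> cone_pdist x y.
Proof.
have [M xM] := cone_fun_bounded x; have [N yN] := cone_fun_bounded y.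
apply: (@ultra_bounded_cvg _ (M + N)) => i.
rewrite ger0_norm; last by rewrite divr_ge0 ?mdist_ge0.
apply: le_trans (lerD (xM i) (yN i)); rewrite -mulrDl ler_pM2r ?invr_gt0//.
by rewrite [mdist (val y i) _]metric_sym metric_triangle.
Qed.

Lemma cone_pdist_sym (x y : cone_fun c d) : cone_pdist x y = cone_pdist y x.
Proof.
by congr (lim (_ @ w)); apply/funext => i; rewrite metric_sym.
Qed.

Lemma cone_pdistxx (x : cone_fun c d) : cone_pdist x x = 0.
Proof.
have := @cone_pdist_cvg x x => /(cvg_lim (@Rhausdorff R)) <-.
apply: (cvg_lim (@Rhausdorff R)).
rewrite (_ : (fun _ => _) = cst 0); first exact: cvg_cst.
by apply/funext => i; rewrite metric_structure.mdistxx mul0r.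
Qed.

Lemma cone_pdist_triangle (y x z : cone_fun c d) :
  cone_pdist x z <= cone_pdist x y + cone_pdist y z.
Proof.
pose f (u v : cone_fun c d) i := mdist (val u i) (val v i) / (d i)%:num.
have fxyz : f x y \+ f y z \- f x z @ w -->
    cone_pdist x y + cone_pdist y z - cone_pdist x z.
  by apply: cvgB; [apply: cvgD|]; exact: cone_pdist_cvg.
rewrite -subr_ge0.
apply: (cvgr_to_ge fxyz).
apply: nearW => i /=.
by rewrite subr_ge0 -mulrDl ler_pM2r ?invr_gt0// metric_triangle.
Qed.

Lemma cone_pdist_ge0 (x y : cone_fun c d) : 0 <= cone_pdist x y.
Proof.
rewrite -(@pmulrn_lge0 _ _ 2)// -(cone_pdistxx x).
by rewrite (le_trans (cone_pdist_triangle y _ _))// (cone_pdist_sym y) mulr2n.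
Qed.

Definition cone_eq (x y : cone_fun c d) : bool := cone_pdist x y == 0.

Lemma cone_eq_refl : reflexive cone_eq.
Proof. by move=> x; rewrite /cone_eq cone_pdistxx. Qed.

Lemma cone_eq_sym : symmetric cone_eq.
Proof. by move=> x y; rewrite /cone_eq cone_pdist_sym. Qed.

Lemma cone_eq_trans : transitive cone_eq.
Proof.
move=> y x z /eqP xy /eqP yz; rewrite /cone_eq eq_le cone_pdist_ge0 andbT.
by apply: le_trans (cone_pdist_triangle y x z) _; rewrite xy yz addr0.
Qed.

Canonical cone_equiv := EquivRel cone_eq cone_eq_refl cone_eq_sym cone_eq_trans.

Definition cone : Type := {eq_quot cone_equiv}.

HB.instance Definition _ := Choice.on cone.
HB.instance Definition _ := EqQuotient.on cone.

Definition cone_dist (p q : cone) : R := cone_pdist (repr p) (repr q).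

Lemma cone_dist_pi (x y : cone_fun c d) :
  cone_dist (\pi_cone x) (\pi_cone y) = cone_pdist x y.
Proof.
have pi0 z : cone_pdist (repr (\pi_cone z)) z = 0.
  by apply/eqP; rewrite -[_ == _]/(cone_eq _ _) -eqmodE reprK.
have le a b a' b' : cone_pdist a a' = 0 -> cone_pdist b b' = 0 ->
    cone_pdist a b <= cone_pdist a' b'.
  move=> aa bb; apply: le_trans (cone_pdist_triangle a' _ _) _.
  rewrite aa add0r; apply: le_trans (cone_pdist_triangle b' _ _) _.
  by rewrite (cone_pdist_sym b') bb addr0.
apply/eqP; rewrite eq_le; apply/andP; split; apply: le => //;
  by rewrite cone_pdist_sym.
Qed.

Let cone_distxx p : cone_dist p p = 0.
Proof. exact: cone_pdistxx. Qed.

Let cone_dist_positivity p q : cone_dist p q = 0 -> p = q.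
Proof.
move=> /eqP pq; rewrite -[p]reprK -[q]reprK; apply/eqP.
by rewrite eqmodE.
Qed.

Let cone_dist_sym p q : cone_dist p q = cone_dist q p.
Proof. exact: cone_pdist_sym. Qed.

Let cone_dist_triangle q p r : cone_dist p r <= cone_dist p q + cone_dist q r.
Proof. exact: cone_pdist_triangle. Qed.

HB.instance Definition _ := @isMetric.Build R cone cone_dist
  cone_distxx cone_dist_positivity cone_dist_sym cone_dist_triangle.

Lemma cone_mdistE (x y : cone_fun c d) : mdist (\pi_cone x) (\pi_cone y) =
  lim ((fun i => mdist (val x i) (val y i) / (d i)%:num) @ w).
Proof. exact: cone_dist_pi. Qed.

End cone_fun.
Arguments cone {R X I} w c d {wU}.

Section dimensions.
Variable R : realType.

(* the least element of a set of natural numbers, +oo if the set is empty *)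
Definition least_dim (P : set nat) : \bar R :=
  ereal_inf [set (n%:R)%:E | n in P].

(* Arbitrary (not only finite) open covers; on metrizable spaces both
   conventions give the same dimension (Dowker). *)
Definition covering_dim_le (T : topologicalType) (n : nat) : Prop :=
  forall C : set (set T), C `<=` open -> cover C id = setT ->
  exists D : set (set T), [/\ D `<=` open, cover D id = setT,
    forall V, D V -> exists2 U, C U & V `<=` U &
    forall x, [set V | D V /\ V x] #<= `I_n.+1].

Definition covering_dim (T : topologicalType) : \bar R :=
  least_dim (covering_dim_le T).

(* "diam U <= K * r" is spelled out on pairs of points *)
Definition AN_cover (X : metricType R) (n : nat) (K r : R) (C : set (set X)) :=
  [/\ cover C id = setT,
    forall U, C U -> forall x y, U x -> U y -> mdist x y <= K * r &
    forall x, [set U | C U /\ ball x r `&` U !=set0] #<= `I_n.+1].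

Definition dim_AN_le (X : metricType R) (n : nat) : Prop :=
  exists2 K : R, 0 < K &
  forall r, 0 < r -> exists C : set (set X), AN_cover n K r C.

Definition asdim_AN_le (X : metricType R) (n : nat) : Prop :=
  exists2 K : R, 0 < K &
  \forall r \near +oo, exists C : set (set X), AN_cover n K r C.

Definition dim_AN (X : metricType R) : \bar R := least_dim (dim_AN_le X).

Definition asdim_AN (X : metricType R) : \bar R := least_dim (asdim_AN_le X).

End dimensions.

(* Main.v *)
(* For the second inequality, the ultraproducts of the elements of covers of X at scale r * d_i
   cover the cone; picking injections of the elements near x_i into {0, ..., n} and taking their
   limits along the ultrafilter gives an injection of the elements near [x] into {0, ..., n}.
   For the first one, let W be an open cover, and let C_k be covers at scales r_k decreasing fast
   to 0. Choose for each element of C_(k+1) a parent in C_k that it meets. An element of C_k is good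
   if a ball of radius a large multiple of r_k around one of its points lies in a member of W.
   Send a good element to the last element of the chain of its good ancestors, and group together
   the thickenings of the elements that are good with a still larger multiple: these groups
   form an open refinement of W of order at most n + 1. *)
Require Import Defs.
From mathcomp Require Import all_boot all_order all_algebra.
From mathcomp Require Import all_classical all_reals all_analysis.
From mathcomp Require Import lra.

Import Order.TTheory GRing.Theory Num.Theory.
Import numFieldNormedType.Exports.

Local Open Scope classical_set_scope.
Local Open Scope ring_scope.

Lemma card_le_IP {T : Type} (A : set T) (n : nat) :
  (A #<= `I_n)%card <->
  exists f : T -> nat, set_fun A `I_n f /\ {in A &, injective f}.
Proof.
split=> [/pcard_leP[f]|[f [fA f_inj]]].
  by exists f; split; [exact: funS | exact: inj].
have [g gE] := Pfun fA; rewrite gE in f_inj.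
by have [h _] := funPinj f_inj; apply/pcard_leP; squash h.
Qed.

(** * Open refinement from covers at shrinking scales *)

Section good_elements.
Set Implicit Arguments.
Unset Strict Implicit.
Context {R : realType} {X : metricType R} (n : nat) (K : R).
Context (r : nat -> R) (C : nat -> set (set X)).
Hypothesis K1 : 1 <= K.
Hypothesis r_gt0 : forall k, 0 < r k.
Hypothesis r_decr : forall k, 8 * K * r k.+1 <= r k.
Hypothesis C_cover : forall k, AN_cover n K (r k) (C k).
Context (p : nat -> set X -> set X).
Hypothesis p_parent :
  forall k V, C k.+1 V -> C k (p k V) /\ p k V `&` V !=set0.
Context (W : set (set X)).

Definition good (a : R) (k : nat) (V : set X) :=
  exists z U, [/\ V z, W U & ball z (a * r k) `<=` U].

Fixpoint ancestor (k j : nat) (V : set X) : set X :=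
  if j is j'.+1 then ancestor k j' (p (k + j') V) else V.

(** The level is recorded because the same set may belong to several [C k]. *)
Fixpoint top (m : nat) (V : set X) : nat * set X :=
  if m is m'.+1 then
    if `[< good (4 * K) m' (p m' V) >] then top m' (p m' V) else (m, V)
  else (m, V).

Definition piece (T : nat * set X) : set X :=
  [set x | exists m V v, [/\ C m V, good (6 * K) m V, top m V = T, V v
                          & mdist v x < r m / 4]].

Let r_succ_le k : r k.+1 <= r k / 8.
Proof. by have := r_decr k; have := r_gt0 k.+1; have := K1; nra. Qed.

(* Restated over a [realType]: [lra] does not unify the order structures in the library versions. *)
Let mdist_triangle (x y z : X) : mdist x z <= mdist x y + mdist y z.
Proof. exact: metric_triangle. Qed.

Let mdist_sym (x y : X) : mdist x y = mdist y x.
Proof. exact: metric_sym. Qed.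

Let ballE (x y : X) (e : R) : ball x e y = (mdist x y < e).
Proof. by rewrite ballEmdist. Qed.

Let r_leK k : r k <= K * r k.
Proof. by rewrite ler_peMl // ltW. Qed.

Lemma r_noninc k j : r (k + j)%N <= r k.
Proof.
elim: j => [|j IH]; first by rewrite addn0.
rewrite addnS; apply: le_trans IH.
by have := r_succ_le (k + j); have := r_gt0 (k + j); lra.
Qed.

Lemma ancestor_mem k j V : C (k + j)%N V -> C k (ancestor k j V).
Proof.
elim: j V => [|j IH] V /=; first by rewrite addn0.
by rewrite addnS => /p_parent[/IH].
Qed.

Lemma ancestor_close k j V v : C (k + j)%N V -> V v ->
  exists2 a, ancestor k j V a & mdist v a <= r k / 4.
Proof.
(* The sharper bound telescopes: passing from level k + j + 1 to its parent costs a diameter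
   [K * r (k + j).+1], at most a quarter of [r (k + j) - r (k + j).+1]. *)
suff: C (k + j)%N V -> V v ->
    exists2 a, ancestor k j V a & mdist v a <= (r k - r (k + j)%N) / 4.
  move=> H CV Vv; have [a Aa va] := H CV Vv; exists a => //.
  by have := r_gt0 (k + j); lra.
elim: j V v => [|j IH] V v.
  by move=> _ Vv; exists v; rewrite // addn0 subrr mul0r metric_structure.mdistxx.
rewrite addnS => CV Vv; have [CpV [u [pVu Vu]]] := p_parent CV.
have [a Aa ua] := IH _ _ CpV pVu; exists a => //.
have [_ /(_ _ CV v u Vv Vu) vu _] := C_cover (k + j).+1.
have := mdist_triangle v u a; have := r_decr (k + j); have := r_leK (k + j).+1.
by have := r_gt0 (k + j).+1; lra.
Qed.

(** Use a common point of V and its parent as new centre: it is within [K * r k] of the old one, and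
    the new radius is at most [r k / 2]. *)
Lemma good_parent k V : C k.+1 V -> good (4 * K) k (p k V) ->
  good (4 * K) k.+1 V.
Proof.
move=> CV [z [U [pz WU zU]]]; have [CpV [u [pu Vu]]] := p_parent CV.
exists u, U; split=> // y uy; apply: zU; move: uy; rewrite !ballE => uy.
have [_ /(_ _ CpV z u pz pu) zu _] := C_cover k.
have := mdist_triangle z u y; have := r_decr k; have := r_gt0 k.
have := r_gt0 k.+1; have := r_leK k; lra.
Qed.

Lemma good_le (a b : R) k V : a <= b -> good b k V -> good a k V.
Proof.
move=> ab [z [U [Vz WU zU]]]; exists z, U; split=> //.
by apply: subset_trans zU; apply: le_ball; rewrite ler_pM2r.
Qed.

Lemma top_good m V : C m V -> good (4 * K) m V ->
  exists k j, [/\ m = (k + j)%N, top m V = (k, ancestor k j V)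
                & good (4 * K) k (ancestor k j V)].
Proof.
elim: m V => [|m IH] V CV gV; first by exists 0%N, 0%N.
rewrite /=; case: ifPn => [/asboolP gp|_].
  have [k [j [mE -> gA]]] := IH _ (p_parent CV).1 gp.
  by exists k, j.+1; rewrite /= addnS -mE.
by exists m.+1, 0%N; rewrite addn0.
Qed.

(** By [good_parent], goodness descends to every intermediate ancestor, so [top] cannot stop before
    level k. *)
Lemma top_ancestor k j V : C (k + j)%N V -> good (4 * K) k (ancestor k j V) ->
  good (4 * K) (k + j)%N V /\ top (k + j)%N V = top k (ancestor k j V).
Proof.
elim: j V => [|j IH] V; first by rewrite addn0.
rewrite addnS => CV /= /(IH _ (p_parent CV).1)[gp tp]; split.
  exact: good_parent.
by rewrite asboolT.
Qed.

Lemma piece_open T : open (piece T).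
Proof.
rewrite openE => x [m [V [v [CV gV tV Vv vx]]]]; apply/nbhs_ballP.
exists (r m / 4 - mdist v x) => /=; first by rewrite subr_gt0.
move=> y; rewrite ballE => xy; exists m, V, v; split=> //.
by have := mdist_triangle v x y; lra.
Qed.

(** All elements grouped in a piece descend from one good set at level k, so the piece stays within
    [K * r k + r k / 4 + r k / 4] of its centre, less than [4 * K * r k]. *)
Lemma piece_sub T x : piece T x -> exists2 U, W U & piece T `<=` U.
Proof.
move=> [m [V [v [CV gV tV Vv vx]]]].
have [|k [j [_ tE [z [U [zA WU zU]]]]]] := top_good CV.
  by apply: good_le gV; have := K1; lra.
move: tE; rewrite tV => TE.
exists U => // y [m' [V' [v' [CV' gV' tV' Vv' vy']]]].
have [|k' [j' [mE tE' _]]] := top_good CV'.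
  by apply: good_le gV'; have := K1; lra.
move: tE'; rewrite tV' TE => -[kE AE]; rewrite -kE in AE mE.
apply: zU; rewrite ballE; rewrite mE in CV'.
have [a Aa va] := ancestor_close CV' Vv'.
have [_ /(_ _ (ancestor_mem CV') z a) za _] := C_cover k.
rewrite AE in zA; have := za zA Aa.
have := mdist_triangle z a y; have := mdist_triangle a v' y.
have := r_noninc k j'; rewrite -mE (mdist_sym a v').
by have := r_gt0 k; have := r_leK k; lra.
Qed.

Lemma piece_cover x : W `<=` open -> cover W id x -> r @ \oo --> 0 ->
  exists T, piece T x.
Proof.
move=> Wo [U WU /=]; have := Wo _ WU; rewrite openE => /[apply].
move=> /nbhs_ballP[e /= e0 xU] /cvgr0Pnorm_lt/(_ (e / (6 * K)))[].
  by apply: divr_gt0 => //; have := K1; lra.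
move=> m _ /(_ m (leqnn _)) /=; rewrite gtr0_norm // => rm.
have [Ccov _ _] := C_cover m.
have : cover (C m) id x by rewrite Ccov.
move=> [V CV Vx]; exists (top m V), m, V, x; split=> //; last first.
  by rewrite metric_structure.mdistxx divr_gt0.
exists x, U; split=> //; apply: subset_trans xU; apply: le_ball.
rewrite ltr_pdivlMr in rm; last by have := K1; lra.
by rewrite mulrC ltW.
Qed.

(* If m is the least level of a witness for x, then all elements of C m near x are good, so the
   pieces containing x are indexed by the tops of these elements. *)
Lemma piece_card x : ([set V | range piece V /\ V x] #<= `I_n.+1)%card.
Proof.
have [nox|] := pselect (forall T, ~ piece T x).
  rewrite (_ : [set _ | _] = set0) //.
  by rewrite -subset0 => _ [[T _ <-]] /nox.
rewrite -existsNE => -[T0 /contrapT].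
pose P m := `[< exists V v,
  [/\ C m V, good (6 * K) m V, V v & mdist v x < r m / 4] >].
move=> [m0 [V0 [v0 [CV0 gV0 _ Vv0 vx0]]]].
have exP : exists m, P m by exists m0; apply/asboolP; exists V0, v0.
case: (ex_minnP exP) => m /asboolP[V [v [CV [z [U [Vz WU zU]]] Vv vx]]] m_min.
have [_ diamV cardV] := C_cover m.
apply: card_le_trans (cardV x).
pose S := [set A | C m A /\ ball x (r m) `&` A !=set0].
apply: (@card_le_trans _ _ _ ((fun A => piece (top m A)) @` S));
  last exact: card_image_le.
apply: subset_card_le => _ [[T _ <-] [m' [V' [v' [CV' gV' tV' Vv' vx']]]]].
have mm' : (m <= m')%N by apply: m_min; apply/asboolP; exists V', v'.
rewrite -(subnKC mm') in CV' gV' tV' vx'; set j := (m' - m)%N in CV' gV' tV' vx'.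
have [a Aa va] := ancestor_close CV' Vv'.
have CA := ancestor_mem CV'.
have xa : mdist x a <= r m / 2.
  have := mdist_triangle x v' a; rewrite (mdist_sym x v').
  by have := r_noninc m j; lra.
exists (ancestor m j V').
  split=> //; exists a; split=> //; rewrite ballE.
  by have := r_gt0 m; lra.
rewrite -(top_ancestor CV' _).2 ?tV'//.
(* The multiple 6 pays for [K * r m] from z to v, [r m / 4] to x, [r m / 2] to a, and [4 * K * r m]
   to y. *)
exists a, U; split=> //; apply: subset_trans zU => y; rewrite ballE => ay.
rewrite ballE.
have := diamV _ CV z v Vz Vv.
have := mdist_triangle z v y; have := mdist_triangle v x y.
have := mdist_triangle x a y; have := r_gt0 m; have := r_leK m; lra.
Qed.

End good_elements.

(** * Covering dimension against Assouad-Nagata dimension *)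

(** A parent is found through a point of its child, so empty elements must be discarded. *)
Lemma AN_cover_nonempty {R : realType} {X : metricType R} n (K r : R)
    (C : set (set X)) :
  AN_cover n K r C -> AN_cover n K r (C `&` [set U | U !=set0]).
Proof.
move=> [Ccov Cdiam Ccard]; split.
- apply/seteqP; split=> // x _; have : cover C id x by rewrite Ccov.
  by move=> [U CU Ux]; exists U => //; split=> //; exists x.
- by move=> U [CU _]; exact: Cdiam.
- move=> x; apply: card_le_trans (Ccard x); apply: subset_card_le.
  by move=> U [[CU _] xU].
Qed.

Lemma AN_cover_le {R : realType} {X : metricType R} n (K K' r : R)
    (C : set (set X)) :
  0 < r -> K <= K' -> AN_cover n K r C -> AN_cover n K' r C.
Proof.
move=> r0 KK' [Ccov Cdiam Ccard]; split=> // U CU x y Ux Uy.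
by apply: le_trans (Cdiam _ CU _ _ Ux Uy) _; rewrite ler_pM2r.
Qed.

Lemma covering_dim_le_dim_AN_le {R : realType} (X : metricType R) n :
  dim_AN_le X n -> covering_dim_le X n.
Proof.
move=> [K0 K0_gt0 dimX] W Wo Wcov.
pose K := Num.max 1 K0; pose q := (8 * K)^-1; pose r k := q ^+ k.
have K1 : 1 <= K by rewrite le_max lexx.
have q0 : 0 < q by rewrite invr_gt0; lra.
have q1 : q < 1 by rewrite invf_lt1; lra.
have r_gt0 k : 0 < r k by rewrite exprn_gt0.
have r_decr k : 8 * K * r k.+1 <= r k.
  by rewrite /r exprS mulrA divff ?mul1r//; lra.
have r0 : r @ \oo --> 0 by apply: cvg_expr; rewrite gtr0_norm.
have C0_ex k : exists C : set (set X), AN_cover n K (r k) C.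
  have [C CP] := dimX _ (r_gt0 k); exists C; apply: AN_cover_le CP => //.
  by rewrite le_max lexx orbT.
have [C0 C0P] := choice C0_ex.
pose C k := C0 k `&` [set U | U !=set0].
have CP k : AN_cover n K (r k) (C k) by exact: AN_cover_nonempty.
have p_ex (kV : nat * set X) :
    exists U, C kV.1.+1 kV.2 -> C kV.1 U /\ U `&` kV.2 !=set0.
  case: kV => k V /=; have [[_ [v Vv]]|] := pselect (C k.+1 V); last by exists V.
  have [Ccov _ _] := CP k; have : cover (C k) id v by rewrite Ccov.
  by move=> [U CU Uv]; exists U => _; split=> //; exists v.
have [p p_parent] := choice p_ex.
(* [piece_sub] needs a point of the piece to produce a member of W. *)
exists (range (piece K r C (fun k V => p (k, V)) W) `&` [set V | V !=set0]).
have parentP k V := p_parent (k, V).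
split.
- by move=> _ [[T _ <-] _]; exact: piece_open.
- apply/seteqP; split=> // x _.
  have [T Tx] : exists T, piece K r C (fun k V => p (k, V)) W T x.
    by apply: (piece_cover K1 r_gt0 CP) => //; rewrite Wcov.
  by exists (piece K r C (fun k V => p (k, V)) W T) => //; split=> //; exists x.
- by move=> _ [[T _ <-] [x /(piece_sub K1 r_gt0 r_decr CP parentP)]].
- move=> x.
  apply: card_le_trans (piece_card K1 r_gt0 r_decr CP parentP W x).
  by apply: subset_card_le => V [[DV _] Vx].
Qed.

(** * Ultraproduct covers of the cone *)

Lemma ultra_bounded_nat {I : Type} (w : set_system I) {wU : UltraFilter w}
    (f : I -> nat) n :
  w [set i | (f i < n)%N] -> exists2 j, (j < n)%N & w [set i | f i = j].
Proof.
elim: n => [|n IH] fn.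
  by case: (filter_not_empty w); apply: filterS fn.
have [wn|wn] := in_ultra_setVsetC [set i | (f i < n)%N] wU.
  by have [j jn wj] := IH wn; exists j => //; exact: ltnW.
exists n => //; apply: filterS2 fn wn => i /=.
by rewrite ltnS leq_eqVlt => /orP[/eqP//|].
Qed.

Section cone_cover.
Context {R : realType} {X : metricType R} {I : Type} (w : set_system I).
Context {wU : UltraFilter w} (c : I -> X) (d : I -> {posnum R}).
Implicit Types (p q : cone w c d) (U V : I -> set X).

(** Membership is tested on the chosen representative only, so invariance under a change of
    representative is not an issue. *)
Definition cone_set U : set (cone w c d) :=
  [set p | w [set i | U i (val (repr p) i)]].

Definition cone_family (C : I -> set (set X)) : set (set (cone w c d)) :=
  [set cone_set U | U in [set U | w [set i | C i (U i)]]].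

Lemma cone_set_eq U V : w [set i | U i = V i] -> cone_set U = cone_set V.
Proof.
by move=> UV; apply/seteqP; split=> p; apply: filterS2 UV => i /= ->.
Qed.

Lemma cone_AN_cover n (K r : R) (C : I -> set (set X)) :
  w [set i | AN_cover n K (r * (d i)%:num) (C i)] ->
  AN_cover n K r (cone_family C).
Proof.
move=> wC; split.
- apply/seteqP; split=> // p _.
  have U_ex i : exists V : set X, AN_cover n K (r * (d i)%:num) (C i) ->
      C i V /\ V (val (repr p) i).
    have [[Ccov _ _]|] := pselect (AN_cover n K (r * (d i)%:num) (C i));
      last by exists set0.
    have : cover (C i) id (val (repr p) i) by rewrite Ccov.
    by move=> [V CV Vp]; exists V.
  have [U UP] := choice U_ex.
  exists (cone_set U); last by apply: filterS wC => i /UP[].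
  by exists U => //; apply: filterS wC => i /UP[].
- move=> _ [U wU' <-] p q Up Uq.
  rewrite -[mdist p q]/(cone_pdist w (repr p) (repr q)).
  apply: (cvgr_to_le (@cone_pdist_cvg _ _ _ w c d _ (repr p) (repr q))).
  apply: filterS (filterI (filterI wC wU') (filterI Up Uq)).
  move=> i [[[_ Cdiam _] CU] [Upi Uqi]].
  by rewrite ler_pdivrMr// -mulrA; exact: Cdiam Upi Uqi.
- move=> p; apply/card_le_IP.
  pose S i := [set V | C i V /\
    ball (val (repr p) i) (r * (d i)%:num) `&` V !=set0].
  have g_ex i : exists g : set X -> nat, AN_cover n K (r * (d i)%:num) (C i) ->
      set_fun (S i) `I_n.+1 g /\ {in S i &, injective g}.
    have [[_ _ Ccard]|] := pselect (AN_cover n K (r * (d i)%:num) (C i));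
      last by exists (fun=> 0%N).
    by have /card_le_IP[g gP] := Ccard (val (repr p) i); exists g.
  have [g gP] := choice g_ex.
  (* The label j of P comes with a family U presenting P, so that two sets with equal labels can be
     compared coordinatewise. *)
  have f_ex (P : set (cone w c d)) : exists j,
      cone_family C P /\ ball p r `&` P !=set0 -> (j < n.+1)%N /\
      exists U, [/\ P = cone_set U, w [set i | S i (U i)]
                  & w [set i | g i (U i) = j]].
    have [|] := pselect (cone_family C P /\ ball p r `&` P !=set0);
      last by exists 0%N.
    move=> [[U CU <-] [q [pq Uq]]].
    have wS : w [set i | S i (U i)].
      (* Balls are open: a strict inequality for the limit holds at w-almost every i. *)
      have pq_lt : cone_pdist w (repr p) (repr q) < r.
        by move: pq; rewrite ballEmdist.
      have near_lt : \forall i \near w,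
          mdist (val (repr p) i) (val (repr q) i) / (d i)%:num < r.
        by apply: cvgr_lt pq_lt; exact: cone_pdist_cvg.
      apply: filterS3 near_lt CU Uq => i /= + CUi Uqi.
      rewrite ltr_pdivrMr// => pqi; split=> //.
      by exists (val (repr q) i); split=> //; rewrite ballEmdist.
    have [|j jn wj] := @ultra_bounded_nat _ _ wU (fun i => g i (U i)) n.+1.
      by apply: filterS2 wC wS => i /gP[gS _] /gS.
    by exists j => _; split=> //; exists U.
  have [f fP] := choice f_ex.
  exists f; split=> [P /fP[]//|P Q].
  move=> /set_mem/fP[_ [U [-> SU gU]]] /set_mem/fP[_ [V [-> SV gV]]] fPQ.
  apply: cone_set_eq.
  apply: filterS (filterI (filterI wC (filterI SU SV)) (filterI gU gV)).
  move=> i [[/gP[_ g_inj] [SUi SVi]] [gUi gVi]].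
  by apply: g_inj; rewrite ?inE// gUi gVi.
Qed.

(** Scale r in the cone is scale [r * d i] in X, which exceeds any threshold M for w-almost all i,
    however small r is. *)
Lemma asdim_AN_le_cone n :
  (fun i => ((d i)%:num)^-1) @ w --> (0 : R) ->
  asdim_AN_le X n -> dim_AN_le (cone w c d) n.
Proof.
move=> d_infty [K K0 [M [_ MP]]]; exists K => // r r0.
have C_ex i : exists C : set (set X), M < r * (d i)%:num ->
    AN_cover n K (r * (d i)%:num) C.
  have [/MP[C CP]|] := pselect (M < r * (d i)%:num); first by exists C.
  by exists set0.
have [C CP] := choice C_ex.
exists (cone_family C); apply: cone_AN_cover.
(* M may be zero or negative; this positive bound above it can be divided by. *)
have M0 : 0 < `|M| + 1 by rewrite ltr_wpDl.
have dr : \forall i \near w, ((d i)%:num)^-1 < r / (`|M| + 1).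
  by apply: (cvgr_lt _ d_infty); exact: divr_gt0.
apply: filterS dr => i di; apply: CP.
move: di; rewrite ltr_pdivlMr// mulrC ltr_pdivrMr//.
by apply: le_lt_trans; rewrite ler_wpDr// ler_norm.
Qed.

End cone_cover.

Theorem corollary4p3 (R : realType) (X : metricType R) (I : Type)
  (I_infinite : infinite_set [set: I])
  (w : set_system I) (w_ultra : UltraFilter w)
  (w_nonprincipal : forall i : I, w <> principal_filter i)
  (c : I -> X) (d : I -> {posnum R})
  (d_infinite : (fun i => ((d i)%:num)^-1) @ w --> (0 : R)) :
  (covering_dim R (cone w c d) <= dim_AN (cone w c d))%E /\
  (dim_AN (cone w c d) <= asdim_AN X)%E.
Proof.
split; apply: ereal_inf_le_tmp => _ [n nP <-]; exists n => //.
  exact: covering_dim_le_dim_AN_le.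
exact: asdim_AN_le_cone.
Qed.
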